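(* Let $\phi\in\mathcal A$, let $K$ be a compact subset of $\mathbb R^2$ and let $\epsilon>0$. Suppose there is a constant $L$ such that for all $a,a'\in\mathbb R$, $$|f_{a'}'(x)-f_a'(x)|\le L\cdot|f_{a'}(x)-f_a(x)|\,\log\frac{1}{|f_{a'}(x)-f_a(x)|}\quad\text{for all }x\in\mathbb R.$$ Then there exists a function $\psi\in\mathcal C^1(\mathbb R^2)$ such that for every point $(x,y)=(x,f_a(x))\in K$, $$|\psi(x,y)-\phi(x,y)|<\epsilon,\qquad \left|\frac{d}{dx}[\psi(x,f_a(x))]-\frac{d}{dx}[\phi(x,f_a(x))]\right|<\epsilon .$$
   Context: For every $a\in\mathbb R$ a $\mathcal C^1$ function $f_a:\mathbb R\to\mathbb R$ is given, with graph $\Gamma_a=\{(x,f_a(x)):x\in\mathbb R\}$ and $f_a(0)=a$. The graphs $\Gamma_a$ are pairwise disjoint and there is a graph through each point of $\mathbb R^2$. The slope function $F:\mathbb R^2\to\mathbb R$, $F(x,y)=f_a'(x)$ where $y=f_a(x)$, is continuous on $\mathbb R^2$. $\mathcal A$ is the class of functions $\phi\in\mathcal C(\mathbb R^2)$ (continuous, real-valued) such that for every $a$ the restriction $\phi|_{\Gamma_a}$ is $\mathcal C^1$ (i.e. $x\mapsto\phi(x,f_a(x))$ is $\mathcal C^1$) and such that the function $\Phi(x,y):=\frac{d}{dx}[\phi(x,f_a(x))]$, where $y=f_a(x)$, is continuous on $\mathbb R^2$. *)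

(* Defs.v *)
From Stdlib Require Import Reals List.
From Coquelicot Require Import Coquelicot.
Open Scope R_scope.

Definition graph (g : R -> R) (p : R * R) : Prop := snd p = g (fst p).

Definition C1 (g : R -> R) : Prop :=
  forall x, ex_derive g x /\ continuous (Derive g) x.

Definition partial_x (g : R * R -> R) (p : R * R) : R :=
  Derive (fun t => g (t, snd p)) (fst p).

Definition partial_y (g : R * R -> R) (p : R * R) : R :=
  Derive (fun t => g (fst p, t)) (snd p).

(* [Derive] is total, hence the separate existence clauses. *)
Definition C1_plane (g : R * R -> R) : Prop :=
  forall p : R * R,
    ex_derive (fun t => g (t, snd p)) (fst p) /\
    ex_derive (fun t => g (fst p, t)) (snd p) /\
    continuous (partial_x g) p /\
    continuous (partial_y g) p.

Definition compact_set {T : UniformSpace} (K : T -> Prop) : Prop :=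
  forall (I : Type) (U : I -> T -> Prop),
    (forall i, open (U i)) ->
    (forall p, K p -> exists i, U i p) ->
    exists l : list I, forall p, K p -> exists i, In i l /\ U i p.

(* In the next two records the function on the plane is determined by the
   displayed identity, since the graphs of the [f a] partition the plane. *)
Record graph_family (f : R -> R -> R) : Prop := {
  graph_family_C1 : forall a, C1 (f a);
  graph_family_0 : forall a, f a 0 = a;
  graph_family_disjoint :
    forall a a', a <> a' -> forall p, ~ (graph (f a) p /\ graph (f a') p);
  graph_family_cover : forall p, exists a, graph (f a) p;
  graph_family_slope :
    exists F : R * R -> R,
      (forall a x, F (x, f a x) = Derive (f a) x) /\
      (forall p, continuous F p)
}.

Record class_A (f : R -> R -> R) (phi : R * R -> R) : Prop := {
  class_A_continuous : forall p, continuous phi p;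
  class_A_C1 : forall a, C1 (fun x => phi (x, f a x));
  class_A_derivative :
    exists Phi : R * R -> R,
      (forall a x, Phi (x, f a x) = Derive (fun t => phi (t, f a t)) x) /\
      (forall p, continuous Phi p)
}.

(* The right-hand side is negative at distances greater than 1, and [f a 0 = a]
   makes all distances occur at [x = 0]; asking for the bound at every distance
   would force [L = 0] and make all graphs vertical translates of one another.
   The bound is therefore asked only at distances below a threshold [delta].
   For [a = a'] both sides are 0. *)
Definition log_lipschitz (f : R -> R -> R) (L delta : R) : Prop :=
  forall a a' x : R,
    Rabs (f a' x - f a x) < delta ->
    Rabs (Derive (f a') x - Derive (f a) x) <=
      L * Rabs (f a' x - f a x) * ln (1 / Rabs (f a' x - f a x)).

(* Main.v *)
Require Import Defs.
From Stdlib Require Import Reals List Lra ClassicalEpsilon.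
From Coquelicot Require Import Coquelicot.
Open Scope R_scope.

(** Write [A (x, y)] for the label [a] of the leaf through [(x, y)]. It suffices
    to find a [C^1] function [S] which is uniformly close to [A] and has small
    derivative along the leaves: then [psi (x, y)] is the mean of [phi (x, f s x)]
    over [S (x, y) <= s <= S (x, y) + m], with [m] small but fixed before [S].

    Up to an additive constant, [A (x, y)] is the measure of the set of labels
    [b] with [f b x < y]; [S] replaces the indicator of this set by a [C^1] step
    of width [eta], so that no leaf has to be differentiated in its label. With
    [F] the slope, the derivative of [S] along a leaf is an integral of
    [step' * (F (x, f a x) - F (x, f b x)) / eta] over the labels [b] of leaves
    within [eta] of the given one. The integrand is [O(ln (1/eta))] by the
    log-Lipschitz bound, and the same bound, integrated from [x] to [0], shows
    that these labels form an interval of length [O(1 / ln(1/eta)^2)]. *)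

(** * Continuity of composite expressions *)

Lemma continuous_add {T : UniformSpace} (u v : T -> R) p :
  continuous u p -> continuous v p -> continuous (fun q => u q + v q) p.
Proof. apply (continuous_plus u v p). Qed.

Lemma continuous_sub {T : UniformSpace} (u v : T -> R) p :
  continuous u p -> continuous v p -> continuous (fun q => u q - v q) p.
Proof. apply (continuous_minus u v p). Qed.

Lemma continuous_mul {T : UniformSpace} (u v : T -> R) p :
  continuous u p -> continuous v p -> continuous (fun q => u q * v q) p.
Proof. apply (continuous_mult u v p). Qed.

Lemma continuous_pair {T U V : UniformSpace} (u : T -> U) (v : T -> V) p :
  continuous u p -> continuous v p -> continuous (fun q => (u q, v q)) p.
Proof.
intros hu hv.
apply (continuous_comp_2 u v (fun a b => (a, b)) p hu hv).
intros P [d hd]; exists d; intros [a b] hq; apply hd; exact hq.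
Qed.

Lemma continuous_after {T U V : UniformSpace} (h : U -> V) (u : T -> U) p :
  (forall q, continuous h q) -> continuous u p -> continuous (fun q => h (u q)) p.
Proof. intros hh hu; apply (continuous_comp u h p hu (hh _)). Qed.

Ltac cont :=
  repeat first
    [ assumption
    | match goal with
      | |- continuous (fun _ => _ + _) _ => apply continuous_add
      | |- continuous (fun _ => _ - _) _ => apply continuous_sub
      | |- continuous (fun _ => _ * _) _ => apply continuous_mul
      | |- continuous (fun _ => (_, _)) _ => apply continuous_pair
      | |- continuous (pair ?c) _ =>
          apply (continuous_pair (fun _ => c) (fun q => q))
      | |- continuous (fun q => q) _ => apply continuous_id
      | |- continuous (fun _ => ?c) _ => apply continuous_const
      | |- continuous fst _ => apply continuous_fst
      | |- continuous snd _ => apply continuous_snd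
      | |- continuous (fun q => fst q) _ => apply continuous_fst
      | |- continuous (fun q => snd q) _ => apply continuous_snd
      | |- continuous (fun _ => fst _) _ =>
          apply (continuous_after fst); [intros; apply continuous_fst |]
      | |- continuous (fun _ => snd _) _ =>
          apply (continuous_after snd); [intros; apply continuous_snd |]
      | h : forall q, continuous ?g q |- continuous (fun q => ?g _) _ =>
          apply (continuous_after g); [exact h |]
      | h : forall q, continuous ?g q |- continuous ?g _ => apply h
      end ].

(** * Integrals depending on a parameter *)

Lemma continuous_continuity_2d_pt (h : R * R -> R) x y :
  continuous h (x, y) -> continuity_2d_pt (fun u v => h (u, v)) x y.
Proof.
intros hc; apply continuity_2d_pt_filterlim.
apply filterlim_ext with (2 := hc); intros [u v]; reflexivity.
Qed.

Lemma ex_RInt_continuous_all (h : R -> R) a b :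
  (forall t, continuous h t) -> ex_RInt h a b.
Proof. intros hh; apply (ex_RInt_continuous (V := R_CompleteNormedModule)); intros; apply hh. Qed.

(** Joint continuity at each [(p, t)] gives a radius depending on [t]. Viewed as a gauge on
    [[a, b]], these radii admit a common lower bound [d] by compactness: every [t] is within the
    gauge of some [s] whose radius is at least [d]. *)
Lemma tube {T : UniformSpace} (h : T * R -> R) (a b : R) (p : T) (eps : posreal) :
  (forall q, continuous h q) ->
  locally p (fun q => forall t, a <= t <= b -> Rabs (h (q, t) - h (p, t)) < eps).
Proof.
intros hh.
assert (hloc : forall t, exists d : posreal, forall q s,
  ball p d q -> Rabs (s - t) < d -> Rabs (h (q, s) - h (p, t)) < eps / 2).
{ intros t.
  destruct (hh (p, t) _ (locally_ball (h (p, t)) (pos_div_2 eps))) as [d hd].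
  exists d; intros q s hq hs; apply (hd (q, s)); split; [exact hq | exact hs]. }
set (delta := fun t => proj1_sig (constructive_indefinite_description _ (hloc t))).
destruct (compactness_value_1d a b delta) as [d hd].
exists d; intros q hq t ht.
destruct (NNPP _ (hd t ht)) as [s [_ [hts hds]]].
assert (hs := proj2_sig (constructive_indefinite_description _ (hloc s))).
fold (delta s) in hs; cbn beta in hs.
assert (h1 := hs q t (ball_le _ _ _ hds _ hq) hts).
assert (h2 := hs p t (ball_center _ _) hts).
replace (h (q, t) - h (p, t))
  with ((h (q, t) - h (p, s)) - (h (p, t) - h (p, s))) by ring.
eapply Rle_lt_trans; [apply Rabs_triang |]; rewrite Rabs_Ropp; lra.
Qed.

Lemma continuous_RInt_param {T : UniformSpace} (h : T * R -> R) (a b : R) (p : T) :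
  a <= b -> (forall q, continuous h q) ->
  continuous (fun q => RInt (fun t => h (q, t)) a b) p.
Proof.
intros hab hh P [eps hP].
assert (hi : forall q, ex_RInt (fun t => h (q, t)) a b).
{ intros q; apply ex_RInt_continuous_all; intros t; cont. }
(* The [+ 1] covers the case [a = b] and makes the final estimate strict. *)
assert (hpos : 0 < eps / (b - a + 1)).
{ apply Rdiv_lt_0_compat; [apply eps | lra]. }
unfold filtermap; generalize (tube h a b p (mkposreal _ hpos) hh).
apply filter_imp; intros q hq; apply hP.
change (Rabs (RInt (fun t => h (q, t)) a b - RInt (fun t => h (p, t)) a b) < eps).
rewrite <- (RInt_minus (V := R_CompleteNormedModule)) by apply hi.
eapply Rle_lt_trans.
- apply (abs_RInt_le_const _ a b (eps / (b - a + 1)) hab).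
  + apply (ex_RInt_minus (V := R_NormedModule)); apply hi.
  + intros t ht; left; apply (hq t ht).
- replace (pos eps) with ((b - a + 1) * (eps / (b - a + 1))) at 2 by (field; lra).
  apply Rmult_lt_compat_r; [exact hpos | lra].
Qed.

Lemma is_derive_RInt_param_continuous (h dh : R * R -> R) (a b x : R) :
  (forall u t, is_derive (fun u => h (u, t)) u (dh (u, t))) ->
  (forall q, continuous h q) -> (forall q, continuous dh q) ->
  is_derive (fun u => RInt (fun t => h (u, t)) a b) x (RInt (fun t => dh (x, t)) a b).
Proof.
intros hd hh hdh.
assert (hD : forall u t, Derive (fun u => h (u, t)) u = dh (u, t)).
{ intros u t; apply is_derive_unique, hd. }
rewrite <- (RInt_ext (fun t => Derive (fun u => h (u, t)) x)) by (intros; apply hD).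
apply (is_derive_RInt_param (fun u t => h (u, t))).
- apply filter_forall; intros u t _; eexists; apply hd.
- intros t _; apply (continuity_2d_pt_ext (fun u v => dh (u, v))).
  + intros u v; symmetry; apply hD.
  + apply continuous_continuity_2d_pt, hdh.
- apply filter_forall; intros u; apply ex_RInt_continuous_all; intros t; cont.
Qed.

Lemma is_derive_RInt_param_bounds (h dh : R * R -> R) (al be : R -> R) (x dal dbe : R) :
  (forall u t, is_derive (fun u => h (u, t)) u (dh (u, t))) ->
  (forall q, continuous h q) -> (forall q, continuous dh q) ->
  is_derive al x dal -> is_derive be x dbe ->
  is_derive (fun u => RInt (fun t => h (u, t)) (al u) (be u)) x
    (RInt (fun t => dh (x, t)) (al x) (be x) - h (x, al x) * dal + h (x, be x) * dbe).
Proof.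
intros hd hh hdh hal hbe.
assert (hD : forall u t, Derive (fun u => h (u, t)) u = dh (u, t)).
{ intros u t; apply is_derive_unique, hd. }
assert (hi : forall u a b, ex_RInt (fun t => h (u, t)) a b).
{ intros u a b; apply ex_RInt_continuous_all; intros t; cont. }
assert (h2 : forall u t,
  continuity_2d_pt (fun u v => Derive (fun z => h (z, v)) u) u t).
{ intros u t; apply (continuity_2d_pt_ext (fun u v => dh (u, v))).
  - intros u' v'; symmetry; apply hD.
  - apply continuous_continuity_2d_pt, hdh. }
assert (h1 : forall t, continuity_pt (fun t => h (x, t)) t).
{ intros t; apply continuity_pt_filterlim.
  change (continuous (fun t => h (x, t)) t); cont. }
unfold Rminus; rewrite Ropp_mult_distr_l.
rewrite <- (RInt_ext (fun t => Derive (fun u => h (u, t)) x)) by (intros; apply hD).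
apply (is_derive_RInt_param_bound_comp (fun u t => h (u, t)) al be); trivial.
- apply filter_forall; intros; apply hi.
- exists (mkposreal 1 Rlt_0_1); apply filter_forall; intros; apply hi.
- exists (mkposreal 1 Rlt_0_1); apply filter_forall; intros; apply hi.
- exists (mkposreal 1 Rlt_0_1); apply filter_forall; intros; eexists; apply hd.
- exists (mkposreal 1 Rlt_0_1); intros; apply h2.
- exists (mkposreal 1 Rlt_0_1); intros; apply h2.
Qed.

(** * A [C^1] step function *)

Definition relu (s : R) : R := Rmax s 0.

Lemma is_derive_relu_sq s : is_derive (fun s => relu s ^ 2) s (2 * relu s).
Proof.
(* A quadratic remainder bound, also across the corner at 0; it lets [eps] itself serve as the
   radius in the limit. *)
assert (hq : forall h, Rabs (relu (s + h) ^ 2 - relu s ^ 2 - 2 * relu s * h) <= h * h).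
{ intros h; unfold relu; apply Rabs_le.
  unfold Rmax; repeat destruct Rle_dec; split; nra. }
apply is_derive_Reals; intros eps heps.
exists (mkposreal eps heps); intros h hh hlt; simpl in hlt.
replace ((relu (s + h) ^ 2 - relu s ^ 2) / h - 2 * relu s)
  with ((relu (s + h) ^ 2 - relu s ^ 2 - 2 * relu s * h) / h) by (field; exact hh).
unfold Rdiv; rewrite Rabs_mult, Rabs_inv.
apply Rle_lt_trans with (2 := hlt).
assert (h0 := Rabs_pos_lt h hh).
apply Rmult_le_reg_r with (Rabs h); [exact h0 |].
rewrite Rmult_assoc, Rinv_l, Rmult_1_r by lra.
rewrite <- Rabs_mult, (Rabs_pos_eq (h * h)) by nra; apply hq.
Qed.

Lemma continuous_relu s : continuous relu s.
Proof.
apply (continuous_ext (fun s => (s + Rabs s) * / 2)).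
- intros t; unfold relu, Rmax, Rabs; destruct Rle_dec, Rcase_abs; lra.
- cont; apply continuous_Rabs.
Qed.

(** Half the second difference of the [C^1] function [relu ^ 2]: a quadratic spline rising from 0 at
    [-1] to 1 at [1], with the hat function [tent] as derivative. *)
Definition step (s : R) : R :=
  (relu (s + 1) ^ 2 - 2 * relu s ^ 2 + relu (s - 1) ^ 2) / 2.

Definition tent (s : R) : R := relu (s + 1) - 2 * relu s + relu (s - 1).

Lemma is_derive_step s : is_derive step s (tent s).
Proof.
assert (h1 := is_derive_relu_sq s).
assert (h2 : is_derive (fun s => relu (s + 1) ^ 2) s (2 * relu (s + 1))).
{ replace (2 * relu (s + 1)) with (scal 1 (2 * relu (s + 1)))
    by (apply (scal_one (V := R_NormedModule))).
  apply (is_derive_comp (fun s => relu s ^ 2) (fun s => s + 1)).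
  - apply is_derive_relu_sq.
  - auto_derive; trivial. }
assert (h3 : is_derive (fun s => relu (s - 1) ^ 2) s (2 * relu (s - 1))).
{ replace (2 * relu (s - 1)) with (scal 1 (2 * relu (s - 1)))
    by (apply (scal_one (V := R_NormedModule))).
  apply (is_derive_comp (fun s => relu s ^ 2) (fun s => s - 1)).
  - apply is_derive_relu_sq.
  - auto_derive; trivial. }
assert (h4 := is_derive_scal _ s (/ 2) _
  (is_derive_plus _ _ s _ _
    (is_derive_minus _ _ s _ _ h2 (is_derive_scal _ s 2 _ h1)) h3)).
match type of h4 with is_derive _ _ ?v => replace (tent s) with v end.
- refine (is_derive_ext _ step s _ _ h4); intros t.
  unfold step, plus, minus, opp, plus; simpl; field.
- unfold tent, plus, minus, opp, plus; simpl; field.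
Qed.

Lemma continuous_step s : continuous step s.
Proof.
apply (ex_derive_continuous (V := R_NormedModule)); eexists; apply is_derive_step.
Qed.

Lemma continuous_tent s : continuous tent s.
Proof. assert (h := continuous_relu); unfold tent; cont.  Qed.

Lemma step_bounds s : 0 <= step s <= 1.
Proof. unfold step, relu, Rmax; repeat destruct Rle_dec; split; nra. Qed.

Lemma step_left s : s <= -1 -> step s = 0.
Proof. intros; unfold step, relu, Rmax; repeat destruct Rle_dec; nra. Qed.

Lemma step_right s : 1 <= s -> step s = 1.
Proof. intros; unfold step, relu, Rmax; repeat destruct Rle_dec; nra. Qed.

Lemma tent_bounds s : 0 <= tent s <= 1.
Proof. unfold tent, relu, Rmax; repeat destruct Rle_dec; nra. Qed.

Lemma tent_support s : 1 <= Rabs s -> tent s = 0.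
Proof.
unfold Rabs; destruct Rcase_abs; intros;
unfold tent, relu, Rmax; repeat destruct Rle_dec; lra.
Qed.

(** * Order and continuity of the leaves *)

Lemma graph_family_continuous f a x : graph_family f -> continuous (f a) x.
Proof.
intros hf; apply (ex_derive_continuous (V := R_NormedModule)).
apply (graph_family_C1 f hf).
Qed.

(** The gap [f a' - f a] is positive at 0, where a leaf takes its label as value. If it failed to be
    positive at [x], the intermediate value theorem would give a common point of two disjoint
    graphs. *)
Lemma graph_family_increasing f a a' x :
  graph_family f -> a < a' -> f a x < f a' x.
Proof.
intros hf ha; apply Rnot_le_lt; intros hle.
set (d := fun t => f a' t - f a t).
assert (hd : forall t, continuous d t).
{ intros t; unfold d; apply continuous_sub; apply graph_family_continuous; exact hf. }
destruct (IVT_gen_consistent d 0 x 0 hd) as [z [_ hz]].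
- unfold d; rewrite !(graph_family_0 f hf).
  split; [eapply Rle_trans; [apply Rmin_r | lra] |].
  eapply Rle_trans; [| apply Rmax_l]; lra.
- apply (graph_family_disjoint f hf a a' ltac:(lra) (z, f a z)).
  unfold graph, d in *; simpl; split; lra.
Qed.

Lemma graph_family_leaf f x y : graph_family f -> exists a, f a x = y.
Proof.
intros hf; destruct (graph_family_cover f hf (x, y)) as [a ha].
exists a; symmetry; exact ha.
Qed.

Lemma graph_family_le_inv f a a' x : graph_family f -> f a x < f a' x -> a < a'.
Proof.
intros hf h; apply Rnot_le_lt; intros [hlt | ->]; [| lra].
assert (h' := graph_family_increasing f a' a x hf hlt); lra.
Qed.

(* Monotonicity in [a] and continuity in [x] give joint continuity: nearby
   leaves squeeze [f a x] between two fixed ones. *)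
Lemma graph_family_jointly_continuous f :
  graph_family f ->
  forall p : R * R, continuous (fun p => f (snd p) (fst p)) p.
Proof.
intros hf [x a] P [eps hP]; simpl in hP.
assert (he := cond_pos eps).
destruct (graph_family_leaf f x (f a x - eps / 2) hf) as [a1 h1].
destruct (graph_family_leaf f x (f a x + eps / 2) hf) as [a2 h2].
assert (ha1 : a1 < a) by (apply (graph_family_le_inv f _ _ x hf); lra).
assert (ha2 : a < a2) by (apply (graph_family_le_inv f _ _ x hf); lra).
destruct (graph_family_continuous f a1 x hf _
  (locally_ball (f a1 x) (pos_div_2 eps))) as [d1 hd1].
destruct (graph_family_continuous f a2 x hf _
  (locally_ball (f a2 x) (pos_div_2 eps))) as [d2 hd2].
assert (hd : 0 < Rmin (Rmin d1 d2) (Rmin (a - a1) (a2 - a))).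
{ repeat apply Rmin_glb_lt; try apply cond_pos; lra. }
exists (mkposreal _ hd); intros [x' a'] [hx' ha']; apply hP.
change (Rabs (x' - x) < Rmin (Rmin d1 d2) (Rmin (a - a1) (a2 - a))) in hx'.
change (Rabs (a' - a) < Rmin (Rmin d1 d2) (Rmin (a - a1) (a2 - a))) in ha'.
change (Rabs (f a' x' - f a x) < eps).
assert (hm1 := Rmin_l (Rmin d1 d2) (Rmin (a - a1) (a2 - a))).
assert (hm2 := Rmin_r (Rmin d1 d2) (Rmin (a - a1) (a2 - a))).
assert (hm3 := Rmin_l d1 d2). assert (hm4 := Rmin_r d1 d2).
assert (hm5 := Rmin_l (a - a1) (a2 - a)). assert (hm6 := Rmin_r (a - a1) (a2 - a)).
assert (hb1 : Rabs (f a1 x' - f a1 x) < eps / 2).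
{ apply hd1; change (Rabs (x' - x) < d1); lra. }
assert (hb2 : Rabs (f a2 x' - f a2 x) < eps / 2).
{ apply hd2; change (Rabs (x' - x) < d2); lra. }
apply Rabs_lt_between in ha', hb1, hb2.
assert (hi1 := graph_family_increasing f a1 a' x' hf ltac:(lra)).
assert (hi2 := graph_family_increasing f a' a2 x' hf ltac:(lra)).
apply Rabs_lt_between; lra.
Qed.

(** The regions between the leaves [- n] and [n] with [Rabs x < n] are open, grow with [n] and
    exhaust the plane, so the largest index of a finite subcover bounds both coordinates. *)
Lemma compact_leaf_bound f K :
  graph_family f -> compact_set K ->
  exists N, 0 <= N /\ forall a x, K (x, f a x) -> Rabs x <= N /\ Rabs a <= N.
Proof.
intros hf hK.
set (U := fun (n : nat) (p : R * R) =>
  Rabs (fst p) < INR n /\ (f (- INR n) (fst p) < snd p /\ snd p < f (INR n) (fst p))).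
assert (hopen : forall g : R * R -> R, (forall p, continuous g p) ->
  open (fun p => 0 < g p)).
{ intros g hg; apply (open_comp g (fun u => 0 < u)).
  - intros p _; apply hg.
  - apply open_gt. }
assert (hc : forall a p, continuous (fun p : R * R => f a (fst p)) p).
{ intros a p; apply (continuous_after (f a)).
  - intros; apply graph_family_continuous, hf.
  - apply continuous_fst. }
destruct (hK nat U) as [l hl].
- intros n; apply open_and; [| apply open_and].
  + apply (open_ext (fun p : R * R => 0 < INR n - Rabs (fst p))).
    { intros p; split; lra. }
    apply hopen; intros p; assert (h := continuous_Rabs); cont.
  + apply (open_ext (fun p : R * R => 0 < snd p - f (- INR n) (fst p))).
    { intros p; split; lra. }
    apply hopen; intros p; apply continuous_sub; [cont | apply hc].
  + apply (open_ext (fun p : R * R => 0 < f (INR n) (fst p) - snd p)).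
    { intros p; split; lra. }
    apply hopen; intros p; apply continuous_sub; [apply hc | cont].
- intros [x y] _; destruct (graph_family_leaf f x y hf) as [a <-].
  destruct (INR_unbounded (Rabs x + Rabs a)) as [n hn].
  assert (hx := Rabs_pos x); assert (ha := Rabs_pos a).
  assert (ha' : Rabs a < INR n) by lra; apply Rabs_lt_between in ha'.
  exists n; unfold U; simpl; split; [lra |].
  split; apply graph_family_increasing; trivial; lra.
- exists (INR (list_max l)); split; [apply pos_INR |]; intros a x hax.
  destruct (hl _ hax) as [n [hn [hx [h1 h2]]]]; simpl in hx, h1, h2.
  assert (hnl : INR n <= INR (list_max l)).
  { apply le_INR.
    assert (h := proj1 (list_max_le l (list_max l)) (Nat.le_refl _)).
    rewrite Forall_forall in h; apply h, hn. }
  apply (graph_family_le_inv f _ _ x hf) in h1, h2.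
  split; [lra |]; apply Rabs_le; lra.
Qed.

(** * Label distance of nearby leaves *)

(** At distances below 1 the logarithm is nonnegative, so replacing [L] by [Rabs L] only enlarges
    the right-hand side; at distance 0 the factor [d] annihilates both versions. *)
Lemma log_lipschitz_normalize f L delta :
  0 < delta -> log_lipschitz f L delta ->
  exists L' delta', 0 <= L' /\ 0 < delta' <= 1 /\ log_lipschitz f L' delta'.
Proof.
intros hd h; exists (Rabs L), (Rmin delta 1).
assert (h1 := Rmin_l delta 1); assert (h2 := Rmin_r delta 1).
split; [apply Rabs_pos |]; split; [split; [apply Rmin_glb_lt |]; lra |].
intros a a' x hx; eapply Rle_trans; [apply h; lra |].
set (d := Rabs (f a' x - f a x)) in *.
assert (hd0 : 0 <= d) by apply Rabs_pos.
destruct hd0 as [hd0 | <-]; [| rewrite !Rmult_0_r, !Rmult_0_l; lra].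
assert (hln : 0 <= ln (1 / d)).
{ rewrite <- ln_1; apply Rcomplements.ln_le; [lra |].
  apply Rmult_le_reg_r with d; [exact hd0 |].
  unfold Rdiv; rewrite !Rmult_1_l, Rinv_l; lra. }
apply Rmult_le_compat_r; [exact hln |].
apply Rmult_le_compat_r; [lra | apply Rle_abs].
Qed.

(* For leaves at distance [d < delta] the log-Lipschitz bound says
   |(ln d)'| <= L ln (1/d), so [ln (1 + ln (delta/d) ^ 2)] is Lipschitz in [x];
   truncating [ln (delta/d)] at 0 makes this true at every distance. *)
Lemma leaf_gap f L delta a a' x X s :
  graph_family f -> 0 <= L -> 0 < delta <= 1 -> log_lipschitz f L delta ->
  Rabs x <= X -> a < a' -> 0 <= s -> f a' x - f a x <= delta * exp (- s) ->
  ln (1 + s ^ 2) - L * (2 - ln delta) * X <=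
    ln (1 + relu (ln delta - ln (a' - a)) ^ 2).
Proof.
intros hf hL hd hlog hx ha hs hgap.
set (d := fun t => f a' t - f a t).
assert (hdpos : forall t, 0 < d t).
{ intros t; assert (h := graph_family_increasing f a a' t hf ha); unfold d; lra. }
assert (hlnd : ln delta <= 0).
{ rewrite <- ln_1; apply Rcomplements.ln_le; lra. }
set (v := fun t => relu (ln delta - ln (d t))).
set (g := fun t => ln (1 + v t ^ 2)).
set (d' := fun t => Derive (f a') t - Derive (f a) t).
assert (hd' : forall t, is_derive d t (d' t)).
{ intros t; apply (is_derive_minus (f a') (f a));
  apply Derive_correct, (graph_family_C1 f hf). }
(* Squaring makes the truncated logarithm differentiable at its corner. *)
assert (hv : forall t, is_derive (fun t => v t ^ 2) t (- (/ d t * d' t) * (2 * v t))).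
{ intros t; apply (is_derive_comp (fun s => relu s ^ 2)); [apply is_derive_relu_sq |].
  replace (- (/ d t * d' t)) with (minus 0 (scal (d' t) (/ d t))).
  2:{ unfold minus, plus, opp, scal; simpl; unfold mult; simpl; ring. }
  apply (is_derive_minus (fun _ => ln delta)).
  - apply (is_derive_const (V := R_NormedModule)).
  - apply (is_derive_comp ln d); [apply is_derive_ln, hdpos | apply hd']. }
set (g' := fun t => - (/ d t * d' t) * (2 * v t) * / (1 + v t ^ 2)).
assert (hg : forall t, is_derive g t (g' t)).
{ intros t; apply (is_derive_comp ln (fun t => 1 + v t ^ 2)).
  - apply is_derive_ln; nra.
  - replace (- (/ d t * d' t) * (2 * v t)) with (plus 0 (- (/ d t * d' t) * (2 * v t))).
    2:{ unfold plus; simpl; ring. }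
    apply (is_derive_plus (fun _ => 1) (fun t => v t ^ 2)).
    + apply (is_derive_const (V := R_NormedModule)).
    + apply hv. }
assert (hbound : forall t, Rabs (g' t) <= L * (2 - ln delta)).
{ intros t; unfold g'.
  assert (hnn : 0 <= L * (2 - ln delta)) by (apply Rmult_le_pos; lra).
  destruct (Rle_dec (v t) 0) as [hv0 | hv0].
  - assert (h0 : v t = 0) by (apply Rle_antisym; [| apply Rmax_r]; lra).
    rewrite h0; match goal with |- Rabs ?e <= _ => replace e with 0 by ring end.
    rewrite Rabs_R0; exact hnn.
  - assert (hveq : v t = ln delta - ln (d t)).
    { unfold v, relu, Rmax in *; destruct Rle_dec; lra. }
    assert (hdt := hdpos t).
    assert (hlt : d t < delta) by (apply ln_lt_inv; lra).
    assert (habs : Rabs (d t) = d t) by (apply Rabs_pos_eq; lra).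
    assert (h := hlog a a' t); change (f a' t - f a t) with (d t) in h.
    rewrite habs in h; specialize (h hlt).
    change (Derive (f a') t - Derive (f a) t) with (d' t) in h.
    unfold Rdiv in h; rewrite Rmult_1_l, ln_Rinv in h by exact hdt.
    rewrite !Rabs_mult, Rabs_Ropp, Rabs_mult, !Rabs_inv, habs.
    rewrite (Rabs_pos_eq 2), (Rabs_pos_eq (v t)), (Rabs_pos_eq (1 + v t ^ 2)) by nra.
    assert (hq : / d t * Rabs (d' t) <= L * (v t - ln delta)).
    { apply Rmult_le_reg_l with (d t); [exact hdt |].
      rewrite <- Rmult_assoc, Rinv_r, Rmult_1_l by lra.
      eapply Rle_trans; [exact h |]; right; rewrite hveq; ring. }
    apply Rmult_le_reg_r with (1 + v t ^ 2); [nra |].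
    rewrite (Rmult_assoc _ (/ (1 + v t ^ 2))), Rinv_l, Rmult_1_r by nra.
    apply Rle_trans with (L * (v t - ln delta) * (2 * v t)).
    + apply Rmult_le_compat_r; [lra | exact hq].
    (* With [v] for [v t], the difference [(2 - ln delta) * (1 + v ^ 2) - 2 * v * (v - ln delta)]
       equals [2 - ln delta * (1 - v) ^ 2], which is positive because [ln delta <= 0]. *)
    + assert (hsq : 0 <= - ln delta * (1 - v t) ^ 2) by (apply Rmult_le_pos; [lra | apply pow2_ge_0]).
      assert (hpoly : 0 <= L * (2 - ln delta * (1 - v t) ^ 2))
        by (apply Rmult_le_pos; lra).
      lra. }
(* At 0 the distance of the two leaves is [a' - a], so comparing [x] with 0 turns a bound on heights
   into one on labels. *)
destruct (MVT_gen g x 0 g') as [c [_ hc]].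
- intros; apply hg.
- intros; apply continuity_pt_filterlim.
  apply (ex_derive_continuous (V := R_NormedModule)); eexists; apply hg.
- assert (hsx : s <= v x).
  { unfold v; eapply Rle_trans; [| apply Rmax_l].
    assert (h : ln (d x) <= ln (delta * exp (- s))).
    { apply Rcomplements.ln_le; [apply hdpos | exact hgap]. }
    rewrite ln_mult, ln_exp in h by (try apply exp_pos; lra); lra. }
  assert (hgx : ln (1 + s ^ 2) <= g x).
  { unfold g; apply Rcomplements.ln_le; nra. }
  assert (hdiff : Rabs (g 0 - g x) <= L * (2 - ln delta) * X).
  { rewrite hc, Rabs_mult, Rminus_0_l, Rabs_Ropp.
    apply Rmult_le_compat; try apply Rabs_pos; trivial. }
  assert (h0 : g 0 = ln (1 + relu (ln delta - ln (a' - a)) ^ 2)).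
  { unfold g, v, d; rewrite !(graph_family_0 f hf); reflexivity. }
  rewrite <- h0; apply Rabs_le_between in hdiff; lra.
Qed.

(** For [a < a'], exponentiating [leaf_gap] gives [1 + s ^ 2 <= E * (1 + w ^ 2)] with
    [w = ln (delta / (a' - a))]. Since [exp w >= (1 + w / 2) ^ 2 >= (1 + w ^ 2) / 4], the label gap
    [delta * exp (- w)] is at most [4 / (1 + w ^ 2)]. *)
Lemma leaf_distance f L delta a a' x X s :
  graph_family f -> 0 <= L -> 0 < delta <= 1 -> log_lipschitz f L delta ->
  Rabs x <= X -> 0 < s -> exp (L * (2 - ln delta) * X) < s ^ 2 ->
  Rabs (f a' x - f a x) <= delta * exp (- s) ->
  Rabs (a' - a) <= 4 * exp (L * (2 - ln delta) * X) / s ^ 2.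
Proof.
intros hf hL hd hlog hx hs hs2; revert a a'.
set (E := exp (L * (2 - ln delta) * X)) in *.
assert (hE : 0 < E) by apply exp_pos.
assert (hlt : forall a a', a < a' -> f a' x - f a x <= delta * exp (- s) ->
  a' - a <= 4 * E / s ^ 2).
{ intros a a' ha h.
  assert (hg := leaf_gap f L delta a a' x X s hf hL hd hlog hx ha ltac:(lra) h).
  set (w := relu (ln delta - ln (a' - a))) in *.
  assert (hw : 1 + s ^ 2 <= E * (1 + w ^ 2)).
  { rewrite <- (exp_ln (1 + s ^ 2)), <- (exp_ln (1 + w ^ 2)) by nra.
    unfold E; rewrite <- exp_plus;
    apply Rnot_lt_le; intros hlt'; apply exp_lt_inv in hlt'; lra. }
  (* The hypothesis [E < s ^ 2] excludes the truncated value [w = 0], so [w] is the logarithm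
     itself. *)
  assert (hwpos : 0 < w).
  { assert (h0 : 0 <= w) by apply Rmax_r.
    destruct h0 as [h0 | h0]; [exact h0 |]; rewrite <- h0 in hw; lra. }
  assert (hweq : w = ln delta - ln (a' - a)).
  { unfold w, relu, Rmax in *; destruct Rle_dec; lra. }
  assert (hexp : (1 + w / 2) ^ 2 <= exp w).
  { replace w with (w / 2 + w / 2) at 2 by field; rewrite exp_plus.
    assert (h1 := exp_ineq1_le (w / 2)); nra. }
  assert (hprod : (a' - a) * exp w <= 1).
  { rewrite hweq; unfold Rminus at 2; rewrite exp_plus, exp_Ropp, !exp_ln by lra.
    replace ((a' - a) * (delta * / (a' - a))) with delta by (field; lra); lra. }
  apply Rmult_le_reg_r with (s ^ 2); [nra |].
  unfold Rdiv; rewrite Rmult_assoc, Rinv_l, Rmult_1_r by nra.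
  assert (h1 : 0 <= (a' - a) * (exp w - (1 + w / 2) ^ 2)) by (apply Rmult_le_pos; lra).
  assert (h2 : (a' - a) * (1 + w ^ 2) <= 4) by nra.
  assert (h3 : 0 <= E * (4 - (a' - a) * (1 + w ^ 2))) by (apply Rmult_le_pos; lra).
  assert (h4 : 0 <= (a' - a) * (E * (1 + w ^ 2) - (1 + s ^ 2)))
    by (apply Rmult_le_pos; lra).
  nra. }
assert (h0 : 0 <= 4 * E / s ^ 2) by (apply Rdiv_le_0_compat; nra).
intros a a' h; apply Rabs_le_between in h.
destruct (Rtotal_order a a') as [ha | [<- | ha]].
- rewrite Rabs_pos_eq by lra; apply hlt; [exact ha | lra].
- rewrite Rminus_diag, Rabs_R0; exact h0.
- rewrite Rabs_minus_sym, Rabs_pos_eq by lra; apply hlt; [exact ha | lra].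
Qed.

(** For [eta = delta * exp (- s)] the factor [1 - ln eta] grows linearly in [s], while the label
    distance [r] supplied by [leaf_distance] decays like [1 / s ^ 2]; the product is small for large
    [s]. *)
Lemma smoothing_scale f L delta X m :
  graph_family f -> 0 <= L -> 0 < delta <= 1 -> log_lipschitz f L delta ->
  0 <= X -> 0 < m ->
  exists eta r, 0 < eta < delta /\ 0 <= r <= m /\ 2 * r * (L * (1 - ln eta)) <= m /\
    forall a a' x, Rabs x <= X -> Rabs (f a' x - f a x) < eta -> Rabs (a' - a) <= r.
Proof.
intros hf hL hd hlog hX hm.
set (E := exp (L * (2 - ln delta) * X)).
assert (hE : 0 < E) by apply exp_pos.
assert (hlnd : ln delta <= 0).
{ rewrite <- ln_1; apply Rcomplements.ln_le; lra. }
set (k := L * (2 - ln delta)).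
assert (hk : 0 <= k) by (apply Rmult_le_pos; lra).
(* Together the summands give [1 <= s], [E < s ^ 2] and [4 * E * (1 + 2 * k) <= m * s]. The last
   becomes [r * s * (1 + 2 * k) <= m], which bounds both [r] and [2 * r * s * k] by [m]. *)
set (s := 1 + E + 4 * E * (1 + 2 * k) / m).
assert (hq : 0 <= 4 * E * (1 + 2 * k) / m) by (apply Rdiv_le_0_compat; nra).
assert (hs1 : 1 <= s) by (unfold s; lra).
assert (hsE : E < s ^ 2) by (assert (E < s) by (unfold s; lra); nra).
assert (hsm : 4 * E * (1 + 2 * k) <= m * s).
{ unfold s; replace (m * (1 + E + 4 * E * (1 + 2 * k) / m))
    with (m * (1 + E) + 4 * E * (1 + 2 * k)) by (field; lra).
  assert (0 <= m * (1 + E)) by (apply Rmult_le_pos; lra); lra. }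
assert (hr : 4 * E / s ^ 2 * s ^ 2 = 4 * E) by (field; lra).
assert (hr0 : 0 <= 4 * E / s ^ 2) by (apply Rdiv_le_0_compat; nra).
set (r := 4 * E / s ^ 2) in *.
assert (hrs : r * s * (1 + 2 * k) <= m).
{ apply Rmult_le_reg_r with s; [lra |].
  replace (r * s * (1 + 2 * k) * s) with (r * s ^ 2 * (1 + 2 * k)) by ring.
  rewrite hr; exact hsm. }
assert (hrk : 0 <= r * s * k) by (apply Rmult_le_pos; [apply Rmult_le_pos |]; lra).
exists (delta * exp (- s)), r; split; [| split; [| split]].
- assert (h := exp_pos (- s)).
  assert (h1 : exp (- s) < 1) by (rewrite <- exp_0; apply exp_increasing; lra).
  split; nra.
- split; [exact hr0 | nra].
- rewrite ln_mult, ln_exp by (try apply exp_pos; lra).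
  assert (h : 1 - (ln delta + - s) <= s * (2 - ln delta)) by nra.
  apply Rle_trans with (2 * (r * s * k)); [| nra].
  replace (2 * (r * s * k)) with (2 * r * (L * (s * (2 - ln delta))))
    by (unfold k; ring).
  apply Rmult_le_compat_l; [lra |]; apply Rmult_le_compat_l; lra.
- intros a a' x hx h.
  apply (leaf_distance f L delta a a' x X s); trivial; lra.
Qed.

(** * The smoothed label and its derivatives *)

(* [step] is applied to the signed height over the leaf [b], in units of [eta];
   subtracting [N] normalises the value to about [a] on the leaf [a]. *)
Definition smooth_label (f : R -> R -> R) (N eta : R) (p : R * R) : R :=
  RInt (fun b => step ((snd p - f b (fst p)) * / eta)) (- N) N - N.

(** The curve [y] is arbitrary because two cases are needed: a leaf, for the derivative along it,
    and a horizontal line, for the partial derivative in [x]. *)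
Lemma is_derive_smooth_label_curve f N eta F (y y' : R -> R) x :
  graph_family f ->
  (forall a x, F (x, f a x) = Derive (f a) x) -> (forall p, continuous F p) ->
  (forall t, is_derive y t (y' t)) -> (forall t, continuous y' t) ->
  is_derive (fun t => smooth_label f N eta (t, y t)) x
    (RInt (fun b => tent ((y x - f b x) * / eta) * ((y' x - F (x, f b x)) * / eta))
      (- N) N).
Proof.
intros hf hFd hF hy hy'.
assert (hj := graph_family_jointly_continuous f hf).
assert (hyc : forall t, continuous y t).
{ intros t; apply (ex_derive_continuous (V := R_NormedModule)); eexists; apply hy. }
assert (hs := continuous_step). assert (ht := continuous_tent).
rewrite <- (Rminus_0_r (RInt _ _ _)).
apply (is_derive_minus (fun t => RInt _ (- N) N) (fun _ => N)).
2:{ apply (is_derive_const (V := R_NormedModule)). }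
apply (is_derive_RInt_param_continuous
  (fun q => step ((y (fst q) - f (snd q) (fst q)) * / eta))
  (fun q => tent ((y (fst q) - f (snd q) (fst q)) * / eta) *
     ((y' (fst q) - F (fst q, f (snd q) (fst q))) * / eta))).
- intros u b; cbn [fst snd]; rewrite Rmult_comm.
  apply (is_derive_comp step (fun u => (y u - f b u) * / eta)).
  + apply is_derive_step.
  + apply (is_derive_ext (fun u => / eta * (y u - f b u))).
    { intros; apply Rmult_comm. }
    rewrite (Rmult_comm _ (/ eta)).
    apply (is_derive_scal (fun u => y u - f b u)).
    apply (is_derive_minus y (f b)); [apply hy |].
    rewrite hFd; apply Derive_correct, (graph_family_C1 f hf).
- intros q; cont.
- intros q; cont.
Qed.

Lemma is_derive_smooth_label_y f N eta x y :
  graph_family f ->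
  is_derive (fun t => smooth_label f N eta (x, t)) y
    (RInt (fun b => tent ((y - f b x) * / eta) * / eta) (- N) N).
Proof.
intros hf; assert (hj := graph_family_jointly_continuous f hf).
assert (hjx : forall b, continuous (fun b => f b x) b).
{ intros b; apply (continuous_after (fun p : R * R => f (snd p) (fst p))
    (fun b => (x, b)) b hj); cont. }
assert (hs := continuous_step). assert (ht := continuous_tent).
rewrite <- (Rminus_0_r (RInt _ _ _)).
apply (is_derive_minus (fun t => RInt _ (- N) N) (fun _ => N)).
2:{ apply (is_derive_const (V := R_NormedModule)). }
apply (is_derive_RInt_param_continuous
  (fun q => step ((fst q - f (snd q) x) * / eta))
  (fun q => tent ((fst q - f (snd q) x) * / eta) * / eta)).
- intros u b; cbn [fst snd]; rewrite Rmult_comm.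
  apply (is_derive_comp step (fun u => (u - f b x) * / eta)).
  + apply is_derive_step.
  + auto_derive; [trivial | ring].
- intros q.
  assert (h : forall q : R * R, continuous (fun q => f (snd q) x) q).
  { intros; apply (continuous_after (fun b => f b x)); cont. }
  cont.
- intros q.
  assert (h : forall q : R * R, continuous (fun q => f (snd q) x) q).
  { intros; apply (continuous_after (fun b => f b x)); cont. }
  cont.
Qed.

Lemma RInt_split3 (h : R -> R) u c d v :
  (forall t, continuous h t) ->
  RInt h u v = RInt h u c + RInt h c d + RInt h d v.
Proof.
intros hh.
rewrite <- (RInt_Chasles h u d v), <- (RInt_Chasles h u c d);
  try (apply ex_RInt_continuous_all, hh); reflexivity.
Qed.

Lemma RInt_eq_const (h : R -> R) u v c :
  u <= v -> (forall t, u < t < v -> h t = c) -> RInt h u v = (v - u) * c.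
Proof.
intros huv h0; rewrite (RInt_ext h (fun _ => c)).
- rewrite RInt_const; reflexivity.
- intros t ht; rewrite Rmin_left, Rmax_right in ht by exact huv; apply h0, ht.
Qed.

(** Leaves with labels outside [[a - r, a + r]] are at height at least [eta] from [f a x], so the
    integrand is 1 below this interval and 0 above it. The integral is thus [N + a - r] plus a
    contribution between 0 and [2 * r]. *)
Lemma smooth_label_near f N eta a x r :
  graph_family f -> 0 < eta -> 0 <= r -> Rabs a + r <= N ->
  (forall b, Rabs (f b x - f a x) < eta -> Rabs (b - a) <= r) ->
  Rabs (smooth_label f N eta (x, f a x) - a) <= r.
Proof.
intros hf heta hr hN hsep; unfold smooth_label; cbn [fst snd].
set (h := fun b => step ((f a x - f b x) * / eta)).
assert (hh : forall b, continuous h b).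
{ assert (hjx : forall b, continuous (fun b => f b x) b).
  { intros b; apply (continuous_after (fun p : R * R => f (snd p) (fst p))
      (fun b => (x, b)) b (graph_family_jointly_continuous f hf)); cont. }
  assert (hs := continuous_step); intros b; unfold h; cont. }
assert (ha : Rabs a <= N - r) by lra; apply Rabs_le_between in ha.
assert (hsep' : forall b, r < Rabs (b - a) -> eta <= Rabs (f b x - f a x)).
{ intros b hb; apply Rnot_lt_le; intros hlt; apply hsep in hlt; lra. }
assert (hinv : forall z, eta <= z -> 1 <= z * / eta).
{ intros z hz; apply Rmult_le_reg_r with eta; [exact heta |].
  rewrite Rmult_assoc, Rinv_l; lra. }
rewrite (RInt_split3 h (- N) (a - r) (a + r) N hh).
rewrite (RInt_eq_const h (- N) (a - r) 1), (RInt_eq_const h (a + r) N 0); try lra.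
- assert (hm : 0 <= RInt h (a - r) (a + r) <= 2 * r); [| apply Rabs_le; lra].
  assert (hi := ex_RInt_continuous_all h (a - r) (a + r) hh).
  split.
  + apply RInt_ge_0; [lra | exact hi |]; intros; apply step_bounds.
  + replace (2 * r) with (RInt (fun _ => 1) (a - r) (a + r)).
    2:{ rewrite RInt_const; unfold scal; simpl; unfold mult; simpl; ring. }
    apply RInt_le; [lra | exact hi | apply ex_RInt_const |].
    intros; apply step_bounds.
- intros b hb; apply step_left.
  assert (h1 := graph_family_increasing f a b x hf ltac:(lra)).
  assert (h2 := hsep' b ltac:(rewrite Rabs_pos_eq; lra)).
  rewrite Rabs_pos_eq in h2 by lra; apply hinv in h2; lra.
- intros b hb; apply step_right.
  assert (h1 := graph_family_increasing f b a x hf ltac:(lra)).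
  assert (h2 := hsep' b ltac:(rewrite Rabs_left; lra)).
  rewrite Rabs_left in h2 by lra; apply hinv in h2; lra.
Qed.

(** The integrand vanishes for labels outside [[a - r, a + r]], and the log-Lipschitz bound limits
    it to [L * (1 - ln eta)] inside. *)
Lemma smooth_label_slope_small f L delta F N eta a x r :
  graph_family f -> 0 <= L -> delta <= 1 -> log_lipschitz f L delta ->
  (forall a x, F (x, f a x) = Derive (f a) x) -> (forall p, continuous F p) ->
  0 < eta < delta -> 0 <= r -> Rabs a + r <= N ->
  (forall b, Rabs (f b x - f a x) < eta -> Rabs (b - a) <= r) ->
  Rabs (RInt (fun b => tent ((f a x - f b x) * / eta) *
    ((F (x, f a x) - F (x, f b x)) * / eta)) (- N) N) <= 2 * r * (L * (1 - ln eta)).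
Proof.
intros hf hL hd hlog hFd hF heta hr hN hsep.
set (h := fun b => tent ((f a x - f b x) * / eta) *
    ((F (x, f a x) - F (x, f b x)) * / eta)).
assert (hh : forall b, continuous h b).
{ assert (hjx : forall b, continuous (fun b => f b x) b).
  { intros b; apply (continuous_after (fun p : R * R => f (snd p) (fst p))
      (fun b => (x, b)) b (graph_family_jointly_continuous f hf)); cont. }
  assert (hs := continuous_tent); intros b; unfold h; cont. }
assert (ha : Rabs a <= N - r) by lra; apply Rabs_le_between in ha.
assert (hout : forall b, eta <= Rabs (f b x - f a x) -> h b = 0).
{ intros b hb; unfold h; rewrite tent_support; [ring |].
  rewrite Rabs_mult, Rabs_inv, (Rabs_pos_eq eta), Rabs_minus_sym by lra.
  apply Rmult_le_reg_r with eta; [lra |]; rewrite Rmult_assoc, Rinv_l; lra. }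
assert (hsep' : forall b, r < Rabs (b - a) -> h b = 0).
{ intros b hb; apply hout, Rnot_lt_le; intros hlt; apply hsep in hlt; lra. }
assert (hlne : ln eta <= 0).
{ rewrite <- ln_1; apply Rcomplements.ln_le; lra. }
assert (hB : 0 <= L * (1 - ln eta)) by (apply Rmult_le_pos; lra).
assert (hin : forall b, Rabs (h b) <= L * (1 - ln eta)).
{ intros b; destruct (Rlt_le_dec (Rabs (f b x - f a x)) eta) as [hb | hb].
  2:{ rewrite (hout b hb), Rabs_R0; exact hB. }
  assert (hl := hlog b a x); rewrite (Rabs_minus_sym (f a x)) in hl.
  specialize (hl ltac:(lra)); rewrite <- !hFd in hl.
  set (z := Rabs (f b x - f a x)) in *.
  (* This follows from [ln u <= u - 1] at [u = eta / z]. The extra summand 1 accounts for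
     [z * ln (1 / z)] not being monotone beyond [exp (- 1)]. *)
  assert (hz : z * ln (1 / z) <= eta * (1 - ln eta)).
  { assert (hz0 : 0 <= z) by apply Rabs_pos.
    destruct hz0 as [hz0 | <-]; [| rewrite Rmult_0_l; nra].
    unfold Rdiv; rewrite Rmult_1_l, ln_Rinv by exact hz0.
    assert (hq : ln (eta * / z) <= eta * / z - 1).
    { assert (hp : 0 < eta * / z).
      { apply Rmult_lt_0_compat; [lra | apply Rinv_0_lt_compat, hz0]. }
      assert (he := exp_ineq1_le (ln (eta * / z))).
      rewrite exp_ln in he by exact hp; lra. }
    rewrite ln_mult, ln_Rinv in hq
      by (try apply Rinv_0_lt_compat; lra).
    assert (hq' : z * (ln eta + - ln z) <= eta - z).
    { replace (eta - z) with (z * (eta * / z - 1)) by (field; lra).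
      apply Rmult_le_compat_l; lra. }
    nra. }
  unfold h; rewrite !Rabs_mult, Rabs_inv, (Rabs_pos_eq eta) by lra.
  assert (ht := tent_bounds ((f a x - f b x) * / eta)).
  rewrite (Rabs_pos_eq (tent _)) by lra.
  set (G := Rabs (F (x, f a x) - F (x, f b x))) in *.
  assert (hG0 : 0 <= G) by apply Rabs_pos.
  assert (hG : G * / eta <= L * (1 - ln eta)).
  { apply Rmult_le_reg_r with eta; [lra |].
    rewrite Rmult_assoc, Rinv_l, Rmult_1_r by lra.
    apply Rle_trans with (1 := hl); rewrite Rmult_assoc.
    apply Rle_trans with (L * (eta * (1 - ln eta))); [| lra].
    apply Rmult_le_compat_l; assumption. }
  assert (hG' : 0 <= G * / eta).
  { apply Rmult_le_pos; [exact hG0 | left; apply Rinv_0_lt_compat; lra]. }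
  nra. }
rewrite (RInt_split3 h (- N) (a - r) (a + r) N hh).
rewrite (RInt_eq_const h (- N) (a - r) 0), (RInt_eq_const h (a + r) N 0); try lra.
- rewrite !Rmult_0_r, Rplus_0_r, Rplus_0_l.
  replace (2 * r) with (a + r - (a - r)) by ring.
  apply abs_RInt_le_const; [lra | apply ex_RInt_continuous_all, hh |].
  intros; apply hin.
- intros b hb; apply hsep'; rewrite Rabs_pos_eq; lra.
- intros b hb; apply hsep'; rewrite Rabs_left; lra.
Qed.

Lemma continuous_smooth_label_integrand (f : R -> R -> R) eta :
  graph_family f ->
  forall q : (R * R) * R,
    continuous (fun q => (snd (fst q) - f (snd q) (fst (fst q))) * / eta) q.
Proof.
intros hf q.
assert (hj : forall q : (R * R) * R, continuous (fun q => f (snd q) (fst (fst q))) q).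
{ intros q'; apply (continuous_after (fun p : R * R => f (snd p) (fst p))
    (fun q => (fst (fst q), snd q)) q' (graph_family_jointly_continuous f hf)); cont. }
apply continuous_mul; [apply continuous_sub; [cont | apply hj] | cont].
Qed.

(** * Averaging over labels *)

Definition average (g : R * R -> R) (m x s : R) : R :=
  / m * RInt (fun t => g (x, t)) s (s + m).

Lemma continuous_average (g : R * R -> R) m (S : R * R -> R) :
  0 < m -> (forall q, continuous g q) -> (forall p, continuous S p) ->
  forall p, continuous (fun p => average g m (fst p) (S p)) p.
Proof.
intros hm hg hS p; apply continuous_mul; [cont |].
(* Translating the variable by [S p] makes the bounds constant. *)
apply (continuous_ext (fun p => RInt (fun t => g (fst p, t + S p)) 0 m)).
- intros q.
  assert (h := RInt_comp_lin (V := R_CompleteNormedModule)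
    (fun t => g (fst q, t)) 1 (S q) 0 m).
  rewrite !Rmult_0_r, Rmult_1_l, Rplus_0_l, (Rplus_comm m) in h.
  refine (eq_trans _ (h _)).
  + apply RInt_ext; intros t _.
    change (g (fst q, t + S q) = 1 * g (fst q, 1 * t + S q)).
    rewrite !Rmult_1_l; reflexivity.
  + apply ex_RInt_continuous_all; intros t; cont.
- apply (continuous_RInt_param (fun z => g (fst (fst z), snd z + S (fst z)))); [lra |].
  intros z; cont.
Qed.

(** The label enters only through the bounds of the integral, so its variation contributes a
    difference quotient of [g], and [g] need only be continuous in the label. *)
Lemma is_derive_average (g dg : R * R -> R) m (S : R -> R) (x dS : R) :
  (forall u t, is_derive (fun u => g (u, t)) u (dg (u, t))) ->
  (forall q, continuous g q) -> (forall q, continuous dg q) ->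
  is_derive S x dS ->
  is_derive (fun u => average g m u (S u)) x
    (average dg m x (S x) + / m * (g (x, S x + m) - g (x, S x)) * dS).
Proof.
intros hd hg hdg hS.
replace (average dg m x (S x) + / m * (g (x, S x + m) - g (x, S x)) * dS)
  with (/ m * (RInt (fun t => dg (x, t)) (S x) (S x + m)
    - g (x, S x) * dS + g (x, S x + m) * dS)) by (unfold average; ring).
apply (is_derive_scal (fun u => RInt _ (S u) (S u + m))).
apply (is_derive_RInt_param_bounds g dg S (fun u => S u + m)); trivial.
rewrite <- (Rplus_0_r dS); apply (is_derive_plus S (fun _ => m)); [exact hS |].
apply (is_derive_const (V := R_NormedModule)).
Qed.

Lemma average_near (g : R * R -> R) m x s c e :
  0 < m -> (forall q, continuous g q) ->
  (forall t, s <= t <= s + m -> Rabs (g (x, t) - c) <= e) ->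
  Rabs (average g m x s - c) <= e.
Proof.
intros hm hg h.
assert (hi : ex_RInt (fun t => g (x, t)) s (s + m)).
{ apply ex_RInt_continuous_all; intros; cont. }
replace (average g m x s - c) with (/ m * RInt (fun t => g (x, t) - c) s (s + m)).
- rewrite Rabs_mult, (Rabs_pos_eq (/ m)) by (left; apply Rinv_0_lt_compat, hm).
  apply Rmult_le_reg_l with m; [exact hm |].
  rewrite <- Rmult_assoc, Rinv_r, Rmult_1_l by lra.
  replace (m * e) with ((s + m - s) * e) by ring.
  apply abs_RInt_le_const; [lra | | exact h].
  apply (ex_RInt_minus (V := R_NormedModule)); [exact hi | apply ex_RInt_const].
- rewrite (RInt_minus (V := R_CompleteNormedModule) (fun t => g (x, t)) (fun _ => c))
    by (exact hi || apply ex_RInt_const).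
  rewrite RInt_const; unfold average, minus, plus, opp, scal; simpl; unfold mult; simpl.
  field; lra.
Qed.

(** Both partial derivatives are expressed through [average] and the partials [Sx] and [Sy] of the
    smoothed label, which are parameter integrals of continuous functions. *)
Lemma C1_plane_average f (F : R * R -> R) N eta m (g dg : R * R -> R) :
  graph_family f ->
  (forall a x, F (x, f a x) = Derive (f a) x) -> (forall p, continuous F p) ->
  0 <= N -> 0 < m ->
  (forall u t, is_derive (fun u => g (u, t)) u (dg (u, t))) ->
  (forall q, continuous g q) -> (forall q, continuous dg q) ->
  C1_plane (fun p => average g m (fst p) (smooth_label f N eta p)).
Proof.
intros hf hFd hF hN hm hd hg hdg.
assert (hi := continuous_smooth_label_integrand f eta hf).
assert (hs := continuous_step). assert (ht := continuous_tent).
set (arg := fun q : (R * R) * R =>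
  (snd (fst q) - f (snd q) (fst (fst q))) * / eta) in *.
assert (hFq : forall q : (R * R) * R,
  continuous (fun q => F (fst (fst q), f (snd q) (fst (fst q)))) q).
{ intros q.
  apply (continuous_after F (fun q => (fst (fst q), f (snd q) (fst (fst q)))) q hF).
  apply continuous_pair; [cont |].
  apply (continuous_after (fun p : R * R => f (snd p) (fst p))
    (fun q => (fst (fst q), snd q)) q (graph_family_jointly_continuous f hf)); cont. }
set (slope := fun q : (R * R) * R => F (fst (fst q), f (snd q) (fst (fst q)))) in *.
set (S := smooth_label f N eta).
(* The [0] is the slope of the horizontal line along which the label is differentiated. *)
set (Sx := fun p : R * R =>
  RInt (fun b => tent (arg (p, b)) * ((0 - slope (p, b)) * / eta)) (- N) N).
set (Sy := fun p : R * R => RInt (fun b => tent (arg (p, b)) * / eta) (- N) N).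
assert (hS : forall p, continuous S p).
{ intros p; apply continuous_sub; [| cont].
  apply (continuous_RInt_param (fun q => step (arg q))); [lra |]; intros; cont. }
assert (hSx : forall p, continuous Sx p).
{ intros p.
  apply (continuous_RInt_param (fun q => tent (arg q) * ((0 - slope q) * / eta)));
    [lra |]; intros; cont. }
assert (hSy : forall p, continuous Sy p).
{ intros p; apply (continuous_RInt_param (fun q => tent (arg q) * / eta)); [lra |].
  intros; cont. }
assert (hdx : forall p, is_derive (fun t => average g m t (S (t, snd p))) (fst p)
  (average dg m (fst p) (S p) +
    / m * (g (fst p, S p + m) - g (fst p, S p)) * Sx p)).
{ intros [x y]; apply (is_derive_average g dg m (fun t => S (t, y))); trivial.
  apply (is_derive_smooth_label_curve f N eta F (fun _ => y) (fun _ => 0)); trivial.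
  - intros; apply (is_derive_const (V := R_NormedModule)).
  - intros; cont. }
assert (hdy : forall p, is_derive (fun t => average g m (fst p) (S (fst p, t))) (snd p)
  (/ m * (g (fst p, S p + m) - g (fst p, S p)) * Sy p)).
{ intros [x y].
  (* On a vertical line [x] is frozen: [is_derive_average] is applied to an integrand independent of
     its first variable, and the average of its zero derivative is the added 0. *)
  rewrite <- (Rplus_0_l (_ * Sy _)).
  replace 0 with (average (fun _ => 0) m y (S (x, y))).
  2:{ unfold average; rewrite RInt_const; unfold scal; simpl; unfold mult; simpl; ring. }
  apply (is_derive_ext
    (fun t => average (fun q : R * R => g (x, snd q)) m t (S (x, t))));
    [reflexivity |].
  apply (is_derive_average (fun q => g (x, snd q)) (fun _ => 0) m (fun t => S (x, t))).
  - intros u t; apply (is_derive_const (V := R_NormedModule) (g (x, t))).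
  - intros; cont.
  - intros; cont.
  - apply is_derive_smooth_label_y, hf. }
assert (hav := continuous_average dg m S hm hdg hS).
intros p; split; [| split; [| split]].
- eexists; apply hdx.
- eexists; apply hdy.
- refine (continuous_ext _ _ p (fun q => eq_sym (is_derive_unique _ _ _ (hdx q))) _).
  apply continuous_add; [apply hav | cont].
- refine (continuous_ext _ _ p (fun q => eq_sym (is_derive_unique _ _ _ (hdy q))) _).
  cont.
Qed.

(** * Uniform continuity and the final estimate *)

Lemma uniform_modulus (g : R * R -> R) X Y e :
  (forall q, continuous g q) -> 0 < e ->
  exists d, 0 < d /\ forall x s t, Rabs x <= X -> Rabs s <= Y -> Rabs t <= Y ->
    Rabs (t - s) < d -> Rabs (g (x, t) - g (x, s)) < e.
Proof.
intros hg he.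
destruct (uniform_continuity_2d (fun x s => g (x, s)) (- X) X (- Y) Y) with
  (eps := mkposreal e he) as [d hd].
- intros; apply continuous_continuity_2d_pt, hg.
- exists d; split; [apply cond_pos |]; intros x s t hx hs ht hst.
  apply hd; try (apply Rabs_le_between; assumption); [| exact hst].
  rewrite Rminus_diag, Rabs_R0; apply cond_pos.
Qed.

Theorem theorem1 (f : R -> R -> R) (hf : graph_family f)
  (phi : R * R -> R) (hphi : class_A f phi)
  (K : R * R -> Prop) (hK : compact_set K)
  (eps : R) (heps : 0 < eps)
  (hL : exists L delta : R, 0 < delta /\ log_lipschitz f L delta) :
  exists psi : R * R -> R,
    C1_plane psi /\
    forall a x : R, K (x, f a x) ->
      Rabs (psi (x, f a x) - phi (x, f a x)) < eps /\
      Rabs (Derive (fun t => psi (t, f a t)) x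
            - Derive (fun t => phi (t, f a t)) x) < eps.
Proof.
destruct hL as [L0 [delta0 [hd0 hlog0]]].
destruct (log_lipschitz_normalize f L0 delta0 hd0 hlog0)
  as [L [delta [hL0 [hdelta hlog]]]].
destruct (graph_family_slope f hf) as [F [hFd hF]].
destruct hphi as [hphic hphiC1 [Phi [hPhid hPhi]]].
destruct (compact_leaf_bound f K hf hK) as [N [hN hKN]].
(* In the coordinates position and label, differentiation along a leaf is differentiation in the
   first variable, and [dg] is that derivative of [g]. *)
set (g := fun q : R * R => phi (fst q, f (snd q) (fst q))).
set (dg := fun q : R * R => Phi (fst q, f (snd q) (fst q))).
assert (hj := graph_family_jointly_continuous f hf).
assert (hg : forall q, continuous g q).
{ intros q; unfold g; cont; apply hj. }
assert (hdg : forall q, continuous dg q).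
{ intros q; unfold dg; cont; apply hj. }
assert (hd : forall u t, is_derive (fun u => g (u, t)) u (dg (u, t))).
{ intros u t; unfold dg; cbn [fst snd]; rewrite hPhid.
  apply Derive_correct, hphiC1. }
destruct (uniform_modulus g N (N + 2) (eps / 4) hg ltac:(lra)) as [d1 [hd1 hu1]].
destruct (uniform_modulus dg N (N + 2) (eps / 4) hdg ltac:(lra)) as [d2 [hd2 hu2]].
(* The averaged labels lie within [r + m <= 2 * m] of [a], which is below both moduli and keeps them
   within [N + 2]. *)
set (m := Rmin 1 (Rmin d1 d2) / 4).
assert (hm1 := Rmin_l 1 (Rmin d1 d2)). assert (hm2 := Rmin_r 1 (Rmin d1 d2)).
assert (hm3 := Rmin_l d1 d2). assert (hm4 := Rmin_r d1 d2).
assert (hm : 0 < m).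
{ unfold m; apply Rdiv_lt_0_compat; [| lra].
  apply Rmin_glb_lt; [lra | apply Rmin_glb_lt; assumption]. }
assert (hmd : 4 * m <= 1 /\ 4 * m <= d1 /\ 4 * m <= d2) by (unfold m; lra).
destruct (smoothing_scale f L delta N m hf hL0 hdelta hlog hN hm)
  as [eta [r [heta [hr [hsmall hsep]]]]].
(* The range [N + 1] leaves room for [Rabs a + r] whenever the leaf [a] meets [K]. *)
set (S := smooth_label f (N + 1) eta).
exists (fun p => average g m (fst p) (S p)); split.
{ apply (C1_plane_average f F (N + 1) eta m g dg); trivial; lra. }
intros a x hax; destruct (hKN a x hax) as [hx ha].
assert (hsepx : forall b, Rabs (f b x - f a x) < eta -> Rabs (b - a) <= r).
{ intros b; apply hsep, hx. }
assert (hSa : Rabs (S (x, f a x) - a) <= r).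
{ apply smooth_label_near; trivial; lra. }
assert (hnear : forall t, S (x, f a x) <= t <= S (x, f a x) + m ->
  Rabs (t - a) <= 2 * m /\ Rabs t <= N + 2).
{ intros t ht; apply Rabs_le_between in hSa, ha.
  split; apply Rabs_le; lra. }
assert (hgnear : forall t, S (x, f a x) <= t <= S (x, f a x) + m ->
  Rabs (g (x, t) - g (x, a)) <= eps / 4).
{ intros t ht; destruct (hnear t ht); left; apply hu1; lra. }
assert (hdgnear : forall t, S (x, f a x) <= t <= S (x, f a x) + m ->
  Rabs (dg (x, t) - dg (x, a)) <= eps / 4).
{ intros t ht; destruct (hnear t ht); left; apply hu2; lra. }
split; cbn [fst].
- apply Rle_lt_trans with (eps / 4); [| lra].
  apply (average_near g m x _ (g (x, a))); assumption.
- set (dS := RInt (fun b => tent ((f a x - f b x) * / eta) *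
    ((F (x, f a x) - F (x, f b x)) * / eta)) (- (N + 1)) (N + 1)).
  assert (hdS : Rabs dS <= m).
  { eapply Rle_trans; [| exact hsmall].
    apply (smooth_label_slope_small f L delta); trivial; lra. }
  assert (hS : is_derive (fun t => S (t, f a t)) x dS).
  { apply (is_derive_smooth_label_curve f (N + 1) eta F (f a)
      (fun t => F (t, f a t))); trivial.
    - intros t; rewrite hFd; apply Derive_correct, (graph_family_C1 f hf).
    - intros t; assert (hc := fun t => graph_family_continuous f a t hf); cont. }
  rewrite (is_derive_unique (fun t : R => average g m t (S (t, f a t))) x _
    (is_derive_average g dg m (fun t => S (t, f a t)) x dS hd hg hdg hS)).
  rewrite <- hPhid.
  assert (h1 := average_near dg m x _ (dg (x, a)) _ hm hdg hdgnear).
  assert (h2 := hgnear (S (x, f a x)) ltac:(lra)).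
  assert (h3 := hgnear (S (x, f a x) + m) ltac:(lra)).
  change (Phi (x, f a x)) with (dg (x, a)).
  set (s := S (x, f a x)) in *.
  (* The bound [Rabs dS <= m] cancels the factor [/ m]. With the error [eps / 4] from the mean of
     [dg], the total is at most [3 * eps / 4]. *)
  assert (h4 : Rabs (/ m * (g (x, s + m) - g (x, s)) * dS) <= eps / 2).
  { rewrite !Rabs_mult, (Rabs_pos_eq (/ m)) by (left; apply Rinv_0_lt_compat, hm).
    assert (h5 : Rabs (g (x, s + m) - g (x, s)) <= eps / 2).
    { apply Rabs_le_between in h2, h3; apply Rabs_le; lra. }
    apply Rle_trans with (/ m * (eps / 2) * m); [| right; field; lra].
    assert (h6 := Rinv_0_lt_compat m hm).
    apply Rmult_le_compat; try apply Rabs_pos; trivial.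
    - apply Rmult_le_pos; [lra | apply Rabs_pos].
    - apply Rmult_le_compat_l; lra. }
  apply Rabs_le_between in h1, h4; apply Rabs_lt_between; lra.
Qed.
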